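(* For every $n\ge1$, $$\mathrm{QEC}(K_1+P_{2n})=-4\sin^2\frac{\pi}{2(2n+1)},\qquad -4\sin^2\frac{\pi}{2(2n+2)}<\mathrm{QEC}(K_1+P_{2n+1})<-4\sin^2\frac{\pi}{2(2n+3)}.$$ Moreover, $-\tfrac12=\mathrm{QEC}(K_1+P_3)<\mathrm{QEC}(K_1+P_4)<\mathrm{QEC}(K_1+P_5)<\cdots$ and $\mathrm{QEC}(K_1+P_n)\to0$ as $n\to\infty$.
   Context: For a finite connected graph $G=(V,E)$ with $|V|\ge2$, let $d(i,j)$ be the graph distance and $D=[d(i,j)]_{i,j\in V}$ the distance matrix. The quadratic embedding constant is $\mathrm{QEC}(G)=\max\{\langle f,Df\rangle : f\in\mathbb{R}^V,\ \langle f,f\rangle=1,\ \langle\mathbf 1,f\rangle=0\}$, where $\mathbf 1$ is the all-ones vector. The fan graph $K_1+P_n$ has vertex set $\{0,1,\dots,n\}$ and edges $\{i,i+1\}$ ($1\le i\le n-1$) and $\{0,i\}$ ($1\le i\le n$). *)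

(* Defs.v *)
From HB Require Import structures.
From mathcomp Require Import all_boot all_order all_algebra.
From mathcomp Require Import all_classical all_reals all_analysis.
Set Implicit Arguments. Unset Strict Implicit. Unset Printing Implicit Defensive.
Import Order.TTheory GRing.Theory Num.Theory.
Local Open Scope ring_scope.
Local Open Scope classical_set_scope.

Fixpoint walkb (T : finType) (adj : rel T) (k : nat) (i j : T) : bool :=
  match k with
  | 0 => i == j
  | k'.+1 => [exists l, adj i l && walkb adj k' l j]
  end.

(* Graph distance: the least k with a walk of length k from i to j.
   For a connected graph on the finite vertex set T this is < #|T|;
   if no such walk exists (disconnected case) the value is #|T|. *)
Definition gdist (T : finType) (adj : rel T) (i j : T) : nat :=
  find (fun k => walkb adj k i j) (iota 0 #|T|).

(* Quadratic embedding constant: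
   sup { <f, D f> : <f,f> = 1, <1,f> = 0 }  (the sup is attained, i.e. a max). *)
Definition QEC (R : realType) (T : finType) (adj : rel T) : R :=
  sup [set q : R | exists f : T -> R,
         \sum_(i : T) f i ^+ 2 = 1 /\ \sum_(i : T) f i = 0 /\
         q = \sum_(i : T) \sum_(j : T) (gdist adj i j)%:R * f i * f j].

Definition fan_adj (n : nat) : rel 'I_n.+1 :=
  fun i j => (i != j) &&
    [|| (val i == 0)%N, (val j == 0)%N,
        ((val i).+1 == val j)%N | ((val j).+1 == val i)%N].

Definition QEC_fan (R : realType) (n : nat) : R := QEC R (@fan_adj n).

(* Main.v *)
(* Eliminating the hub through the constraint sum f = 0 turns <f, D f> into
   - E(F), where F is the restriction of f to the path and
   E(F) = F_0^2 + sum (F_k + F_{k+1})^2 + F_n^2, while <f, f> becomes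
   sum F_k^2 + s^2 with s = sum F_k.  Up to alternating signs E is the Dirichlet
   form of the path with N vertices, with lowest eigenvalue
   l = 2 - 2 cos t = 4 sin^2 (t / 2), t = pi / (N + 1), so QEC >= - l, strictly
   when the ground state has s <> 0, that is when N is odd.
   For N even the ground state substitution writes E - l sum F^2 as
   sum sin ((k+1) t) sin ((k+2) t) (w_{k+1} - w_k)^2; summation by parts and
   Cauchy-Schwarz then bound l s^2 by N' (1 - cos t) / cos t times this sum, with
   N' = N - 1.  The factor is at most 1, with equality only for N = 2, because
   (N / 2 + 1) sin (t / 2) <= 1.  Hence QEC = - l, and for N odd the strict upper
   bound follows by embedding the path into the one with N + 1 vertices. *)
Require Import Defs.
From HB Require Import structures.
From mathcomp Require Import all_boot all_order all_algebra.
From mathcomp Require Import all_classical all_reals all_analysis.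
From mathcomp Require Import ring lra zify.
Set Implicit Arguments.
Unset Strict Implicit.
Unset Printing Implicit Defensive.
Import Order.TTheory GRing.Theory Num.Theory.
Import numFieldNormedType.Exports.
Local Open Scope classical_set_scope.
Local Open Scope ring_scope.

(** * Distances in the fan graph *)

Lemma gdist_fan (n : nat) (i j : 'I_n.+1) :
  gdist (@fan_adj n) i j = if i == j then 0 else if fan_adj i j then 1 else 2.
Proof.
have [->|ij] := eqVneq i j.
  by rewrite /gdist card_ord /= eqxx.
have w1 : walkb (@fan_adj n) 1 i j = fan_adj i j.
  apply/existsP/idP => [[l /andP[il /eqP <-]] //|aij].
  by exists j; rewrite aij /=.
(* Distinct non-adjacent vertices both differ from the hub, which joins them. *)
have w2 : ~~ fan_adj i j -> walkb (@fan_adj n) 2 i j.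
  rewrite {1}/fan_adj ij /= !negb_or => /and4P[i0 j0 _ _].
  apply/existsP; exists ord0; apply/andP; split.
    by rewrite /fan_adj /= orbT andbT -val_eqE.
  by apply/existsP; exists j; rewrite /fan_adj /= eqxx !andbT eq_sym -val_eqE.
rewrite /gdist card_ord.
case: ifPn => aij.
  (* The search covers only lengths up to n, so it must be shown to reach 1 here, and 2 in the other
     case. *)
  have n_gt0 : (0 < n)%N by case: n i j ij {w1 w2 aij} => // i j; rewrite !ord1 eqxx.
  rewrite (_ : iota 0 n.+1 = 0 :: 1 :: iota 2 n.-1)%N; last by case: (n) n_gt0.
  by rewrite [LHS]/= (negPf ij) -[X in if X then _ else _]/(walkb (@fan_adj n) 1 i j) w1 aij.
have n_gt1 : (1 < n)%N.
  move: aij; rewrite /fan_adj ij /= !negb_or => /and4P[i0 j0 _ _].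
  have := ltn_ord i; have := ltn_ord j; move: ij; rewrite -val_eqE /=; lia.
rewrite (_ : iota 0 n.+1 = 0 :: 1 :: 2 :: iota 3 n.-2)%N; last by case: (n) n_gt1 => [|[]].
rewrite [LHS]/= (negPf ij) -[X in if X then _ else _]/(walkb (@fan_adj n) 1 i j) w1 (negPf aij).
by rewrite -[X in if X then _ else _]/(walkb (@fan_adj n) 2 i j) w2.
Qed.

(** * Reduction of the quadratic form to the path *)

Definition path_energy (R : nzRingType) (n : nat) (F : nat -> R) : R :=
  F 0%N ^+ 2 + \sum_(k < n) (F k + F k.+1) ^+ 2 + F n ^+ 2.

Definition path_norm (R : nzRingType) (n : nat) (F : nat -> R) : R :=
  \sum_(k < n.+1) F k ^+ 2 + (\sum_(k < n.+1) F k) ^+ 2.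

(** The two end terms make every square occur exactly twice, so the form has matrix 2I + A, with A
    the adjacency matrix of the path. *)
Lemma path_energyE (R : comNzRingType) (n : nat) (F : nat -> R) :
  path_energy n F =
  2 * (\sum_(k < n.+1) F k ^+ 2) + 2 * (\sum_(k < n) F k * F k.+1).
Proof.
rewrite /path_energy; elim: n => [|n IHn].
  by rewrite big_ord_recr /= !big_ord0; ring.
move: IHn; rewrite (big_ord_recr n.+1) !(big_ord_recr n) /=.
set a := F 0%N ^+ 2; set b := \sum_(k < n) _ => IHn.
rewrite (_ : a + (b + _) + _ = a + b + F n ^+ 2 +
  2 * (F n * F n.+1 + F n.+1 ^+ 2)); last by ring.
by rewrite IHn; ring.
Qed.

Lemma path_adj_sum (R : comNzRingType) (n : nat) (F : nat -> R) :
  \sum_(i < n.+1) \sum_(j < n.+1)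
    ((i.+1 == j)%N || (j.+1 == i)%N)%:R * F i * F j =
  2 * \sum_(k < n) F k * F k.+1.
Proof.
elim: n => [|n IHn]; first by rewrite !big_ord_recr !big_ord0 /=; ring.
rewrite big_ord_recr /=.
under eq_bigr do rewrite big_ord_recr /=.
rewrite big_split /= {}IHn [in RHS]big_ord_recr /=.
have last_col : \sum_(i < n.+1) ((i.+1 == n.+1)%N || (n.+2 == i)%N)%:R * F i * F n.+1
    = F n * F n.+1.
  rewrite big_ord_recr /= eqxx /= big1 ?add0r ?mul1r // => i _.
  have -> : ((i.+1 == n.+1)%N || (n.+2 == i)%N) = false by have := ltn_ord i; lia.
  by rewrite !mul0r.
have last_row : \sum_(j < n.+2) ((n.+2 == j)%N || (j.+1 == n.+1)%N)%:R * F n.+1 * F j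
    = F n * F n.+1.
  rewrite big_ord_recr /= -last_col.
  have -> : ((n.+2 == n.+1)%N || (n.+2 == n.+1)%N) = false by lia.
  by rewrite !mul0r addr0; apply: eq_bigr => i _; rewrite orbC; ring.
by rewrite last_col last_row; ring.
Qed.

Lemma fan_adj_sum (R : comNzRingType) (n : nat) (F : nat -> R) :
  \sum_(i < n.+2) \sum_(j < n.+2) (@fan_adj n.+1 i j)%:R * F i * F j =
  2 * F 0%N * (\sum_(k < n.+1) F k.+1) + 2 * \sum_(k < n) F k.+1 * F k.+2.
Proof.
rewrite big_ord_recl /=.
under [in X in _ + X]eq_bigr do rewrite big_ord_recl /=.
rewrite big_split /= big_ord_recl /= {1}/fan_adj /= !mul0r add0r.
rewrite -(path_adj_sum n (fun k => F k.+1)).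
have -> : \sum_(i < n.+1) (fan_adj (lift ord0 i) ord0)%:R * F (bump 0 i) * F 0%N
   = F 0%N * \sum_(k < n.+1) F k.+1.
  by rewrite mulr_sumr; apply: eq_bigr => i _; rewrite /fan_adj /= mul1r mulrC.
have -> : \sum_(i < n.+1) (fan_adj ord0 (lift ord0 i))%:R * F 0%N * F (bump 0 i)
   = F 0%N * \sum_(k < n.+1) F k.+1.
  by rewrite mulr_sumr; apply: eq_bigr => i _; rewrite /fan_adj /= mul1r.
rewrite addrA; congr (_ + _); first by ring.
apply: eq_bigr => i _; apply: eq_bigr => j _; congr (_%:R * _ * _).
by rewrite /fan_adj -val_eqE /= /bump /=; lia.
Qed.

Lemma fan_quadratic_form (R : comNzRingType) (n : nat) (f : 'I_n.+2 -> R) (F : nat -> R) :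
  \sum_i f i = 0 -> (forall k, (k < n.+1)%N -> F k = f (inord k.+1)) ->
  \sum_i \sum_j (gdist (@fan_adj n.+1) i j)%:R * f i * f j = - path_energy n F
  /\ \sum_i f i ^+ 2 = path_norm n F.
Proof.
move=> f0 Ff.
pose g k := f (inord k).
have fE i : f i = g i by rewrite /g inord_val.
have gF (k : 'I_n.+1) : g k.+1 = F k by rewrite Ff.
have g0 : g 0%N = - \sum_(k < n.+1) F k.
  move: f0; rewrite (eq_bigr _ (fun i _ => fE i)) big_ord_recl /= => /eqP.
  by rewrite addr_eq0 => /eqP ->; congr (- _); apply: eq_bigr => k _; exact: gF.
have sq : \sum_i f i ^+ 2 = path_norm n F.
  rewrite (eq_bigr (fun i : 'I_n.+2 => g i ^+ 2)) => [|i _]; last by rewrite fE.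
  rewrite big_ord_recl /= g0 sqrrN addrC; congr (_ + _).
  by apply: eq_bigr => k _; rewrite -gF.
split=> //.
(* The distance matrix is 2J - 2I - A, with J all ones and A the adjacency matrix of the fan; J
   vanishes on vectors of sum zero. *)
have -> : \sum_i \sum_j (gdist (@fan_adj n.+1) i j)%:R * f i * f j =
   2 * (\sum_i f i) ^+ 2 - 2 * (\sum_i f i ^+ 2)
   - \sum_(i < n.+2) \sum_(j < n.+2) (@fan_adj n.+1 i j)%:R * g i * g j.
  rewrite expr2 mulr_suml !mulr_sumr -!sumrB; apply: eq_bigr => i _.
  have -> : f i ^+ 2 = \sum_j (i == j)%:R * f i * f j.
    rewrite (bigD1 i) //= eqxx mul1r big1 ?addr0 // => j /negPf.
    by rewrite eq_sym => ->; rewrite !mul0r.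
  rewrite !mulr_sumr -!sumrB; apply: eq_bigr => j _.
  rewrite gdist_fan -!fE.
  have [<-|ij] := eqVneq i j; first by rewrite /fan_adj eqxx /=; ring.
  by case: ifP => _ /=; ring.
rewrite f0 sq fan_adj_sum g0 path_energyE /path_norm.
have -> : \sum_(k < n.+1) g k.+1 = \sum_(k < n.+1) F k by apply: eq_bigr => k _; exact: gF.
have -> : \sum_(k < n) g k.+1 * g k.+2 = \sum_(k < n) F k * F k.+1.
  by apply: eq_bigr => k _; rewrite /g !Ff // ltnS // ltnW.
ring.
Qed.

(** * From energy inequalities to bounds on the constant *)

Lemma path_energy_ge0 (R : realDomainType) n (F : nat -> R) : 0 <= path_energy n F.
Proof. by rewrite !addr_ge0 ?sqr_ge0 // sumr_ge0 // => *; exact: sqr_ge0. Qed.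

Lemma path_energyZ (R : comNzRingType) n (c : R) (F : nat -> R) :
  path_energy n (fun k => c * F k) = c ^+ 2 * path_energy n F.
Proof.
rewrite /path_energy !exprMn !mulrDr mulr_sumr; congr (_ + _ + _).
by apply: eq_bigr => k _; ring.
Qed.

Lemma path_normZ (R : comNzRingType) n (c : R) (F : nat -> R) :
  path_norm n (fun k => c * F k) = c ^+ 2 * path_norm n F.
Proof.
rewrite /path_norm -mulr_sumr exprMn !mulrDr mulr_sumr; congr (_ + _).
by apply: eq_bigr => k _; ring.
Qed.

Lemma fan_extend (R : comNzRingType) n (F : nat -> R) :
  exists f : 'I_n.+2 -> R, \sum_i f i = 0 /\
    forall k, (k < n.+1)%N -> F k = f (inord k.+1).
Proof.
exists (fun i => if i == 0%N :> nat then - \sum_(k < n.+1) F k else F i.-1).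
split; first by rewrite big_ord_recl /= addNr.
by move=> k k_lt; rewrite inordK.
Qed.

Lemma le_QEC_fan (R : realType) n (F : nat -> R) (c : R) :
  0 < path_norm n F -> path_energy n F <= c * path_norm n F ->
  - c <= QEC_fan R n.+1.
Proof.
move=> N0 Ec.
have [s s0 sN] : exists2 s : R, 0 < s & s ^+ 2 * path_norm n F = 1.
  exists (Num.sqrt (path_norm n F))^-1; first by rewrite invr_gt0 sqrtr_gt0.
  by rewrite exprVn sqr_sqrtr ?ltW // mulVf ?gt_eqF.
have [f [f0 fF]] := fan_extend n (fun k => s * F k).
have [q sq] := fan_quadratic_form f0 fF.
rewrite path_energyZ in q; rewrite path_normZ sN in sq.
apply: (@le_trans _ _ (- (s ^+ 2 * path_energy n F))).
  by rewrite lerN2 -[leRHS]mulr1 -sN mulrCA ler_pM2l // exprn_gt0.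
apply: ub_le_sup; last by exists f; split=> //; split=> //; rewrite q.
(* The supremum dominates its elements only for a set bounded above; nonnegativity of the energy
   gives the bound 0. *)
exists 0 => _ [g [g1 [g0 ->]]].
have [-> _] := fan_quadratic_form g0 (fun k _ => erefl).
by rewrite oppr_le0 path_energy_ge0.
Qed.

Lemma QEC_fan_le (R : realType) n (c : R) :
  (forall F, c * path_norm n F <= path_energy n F) ->
  QEC_fan R n.+1 <= - c.
Proof.
move=> cE; apply: ge_sup => [|_ [g [g1 [g0 ->]]]]; last first.
  have [-> sq] := fan_quadratic_form g0 (fun k _ => erefl).
  by have := cE (fun k => g (inord k.+1)); rewrite -sq g1 mulr1 lerN2.
(* The set must also be nonempty: the witness is 1/sqrt 2 at the first path vertex, hence -1/sqrt 2
   at the hub. *)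
pose F k : R := (k == 0%N)%:R * (Num.sqrt 2)^-1.
have [f [f0 fF]] := fan_extend n F.
have [q sq] := fan_quadratic_form f0 fF.
exists (- path_energy n F), f; rewrite q sq; split=> //.
rewrite /path_norm /F !big_ord_recl /= ?eqxx !mul1r !big1 => [|i _|i _];
  rewrite ?mul0r ?expr0n // !addr0 exprVn sqr_sqrtr //; lra.
Qed.

(** * Algebraic identities and inequalities for finite sums *)

(* Ground state (Picone) substitution F = (-1)^k S_{k+1} w_k. *)
Lemma picone_path (R : comNzRingType) (n : nat) (c : R) (S w : nat -> R) :
  S 0%N = 0 -> (forall k, S k.+2 = 2 * c * S k.+1 - S k) ->
  let F k := (-1) ^+ k * S k.+1 * w k in
  path_energy n F = (2 - 2 * c) * (\sum_(k < n.+1) F k ^+ 2)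
    + \sum_(k < n) S k.+1 * S k.+2 * (w k.+1 - w k) ^+ 2
    + S n.+2 * S n.+1 * w n ^+ 2.
Proof.
move=> S0 SS F; rewrite /path_energy.
have F2 k : F k ^+ 2 = S k.+1 ^+ 2 * w k ^+ 2.
  by rewrite /F !exprMn sqrr_sign mul1r.
have FF k : (F k + F k.+1) ^+ 2 = (S k.+1 * w k - S k.+2 * w k.+1) ^+ 2.
  rewrite -[RHS]mul1r -(sqrr_sign R k) -exprMn /F (exprS (-1) k); congr (_ ^+ 2); ring.
elim: n => [|n].
  by rewrite big_ord_recr /= !big_ord0 !F2 SS S0; ring.
rewrite (big_ord_recr n.+1) !(big_ord_recr n) /=.
set a := F 0%N ^+ 2; set b := \sum_(k < n) _; set d := \sum_(k < n) F k ^+ 2.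
set e := \sum_(k < n) _ => IHn.
rewrite (_ : a + (b + _) + _ = a + b + F n ^+ 2 +
  ((F n + F n.+1) ^+ 2 - F n ^+ 2 + F n.+1 ^+ 2)); last by ring.
rewrite {}IHn FF !F2 (SS n.+1); ring.
Qed.

Lemma abel_sum (R : comNzRingType) (n : nat) (P w : nat -> R) :
  \sum_(k < n.+1) (P k - P k.+1) * w k =
  P 0%N * w 0%N - P n.+1 * w n + \sum_(k < n) P k.+1 * (w k.+1 - w k).
Proof.
elim: n => [|n IHn]; first by rewrite big_ord_recr !big_ord0 /=; ring.
by rewrite big_ord_recr /= IHn big_ord_recr /=; ring.
Qed.

(** Cauchy-Schwarz against the constant vector, read off the nonnegative double sum of squared
    differences. *)
Lemma sqr_sum_le (R : realDomainType) (n : nat) (x : nat -> R) :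
  (\sum_(k < n) x k) ^+ 2 <= n%:R * \sum_(k < n) x k ^+ 2.
Proof.
have h : 0 <= \sum_(i < n) \sum_(j < n) (x i - x j) ^+ 2.
  by apply: sumr_ge0 => i _; apply: sumr_ge0 => j _; exact: sqr_ge0.
set s := \sum_(k < n) x k in h *; set q := \sum_(k < n) x k ^+ 2.
suff e : \sum_(i < n) \sum_(j < n) (x i - x j) ^+ 2 = 2 * (n%:R * q - s ^+ 2).
  by move: h; rewrite e pmulr_rge0 // subr_ge0.
transitivity (\sum_(i < n) (n%:R * x i ^+ 2 + q - 2 * (x i * s))).
  apply: eq_bigr => i _.
  have -> : n%:R * x i ^+ 2 = \sum_(j < n) x i ^+ 2.
    by rewrite sumr_const card_ord mulr_natl.
  by rewrite /q /s !mulr_sumr -big_split -sumrB; apply: eq_bigr => j _ /=; ring.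
rewrite sumrB big_split /= -!mulr_sumr -mulr_suml sumr_const card_ord -/q -/s.
by rewrite -mulr_natl; ring.
Qed.

(** * Dirichlet eigenvalue and ground state of the path *)

Section PathAngle.
Variable R : realType.
Implicit Type n : nat.

(* Index n refers to the path with n.+1 vertices, numbered from 0. *)
Definition path_angle n : R := pi / n.+2%:R.
Local Notation t := path_angle.

Definition path_eigval n : R := 2 - 2 * cos (t n).

Lemma path_angle_gt0 n : 0 < t n.
Proof. by rewrite divr_gt0 ?pi_gt0. Qed.

Lemma path_angleM n : n.+2%:R * t n = pi.
Proof. by rewrite mulrCA mulfV ?mulr1. Qed.

Lemma sin_path_gt0 n k : (0 < k < n.+2)%N -> 0 < sin (k%:R * t n).
Proof.
move=> /andP[k0 kn]; apply: sin_gt0_pi.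
by rewrite mulr_gt0 ?path_angle_gt0 ?ltr0n //= -(path_angleM n) ltr_pM2r
   ?path_angle_gt0 // ltr_nat.
Qed.

Lemma half_path_angle_gt0 n : 0 < t n / 2.
Proof. by rewrite divr_gt0 ?path_angle_gt0. Qed.

Lemma half_path_angle_lt n : t n / 2 < pi / 2.
Proof.
rewrite ltr_pM2r ?invr_gt0 // -(path_angleM n) -[ltLHS]mul1r.
by rewrite ltr_pM2r ?path_angle_gt0 // ltr1n.
Qed.

Lemma sin_half_path_angle_gt0 n : 0 < sin (t n / 2).
Proof.
by apply: sin_gt0_pihalf; rewrite half_path_angle_gt0 half_path_angle_lt.
Qed.

Lemma cos_half (x : R) : cos x = 1 - 2 * sin (x / 2) ^+ 2.
Proof.
have {1}-> : x = (x / 2) *+ 2 by rewrite -mulr_natr mulfVK.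
by rewrite cos_mulr2n cos2sin2 -mulr_natr; ring.
Qed.

Lemma path_eigvalE n : path_eigval n = 4 * sin (t n / 2) ^+ 2.
Proof. by rewrite /path_eigval cos_half; ring. Qed.

Lemma path_eigval_gt0 n : 0 < path_eigval n.
Proof. by rewrite path_eigvalE mulr_gt0 // exprn_gt0 // sin_half_path_angle_gt0. Qed.

Lemma path_eigval_lt n : path_eigval n.+1 < path_eigval n.
Proof.
rewrite /path_eigval ltrD2l ltrN2 ltr_pM2l // ltr_cos; last first.
- by rewrite in_itv /= ltW ?path_angle_gt0 //= /path_angle ler_pdivrMr //
    -[leLHS]mulr1 ler_pM2l ?pi_gt0 // ler1n.
- by rewrite in_itv /= ltW ?path_angle_gt0 //= /path_angle ler_pdivrMr //
    -[leLHS]mulr1 ler_pM2l ?pi_gt0 // ler1n.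
by rewrite /path_angle ltr_pM2l ?pi_gt0 // ltf_pV2 ?posrE // ltr_nat.
Qed.

Lemma sin_path_rec (x : R) k :
  sin (k.+2%:R * x) = 2 * cos x * sin (k.+1%:R * x) - sin (k%:R * x).
Proof.
rewrite (_ : k.+2%:R * x = k.+1%:R * x + x); last by ring.
have -> : k%:R * x = k.+1%:R * x - x by ring.
by rewrite sinD sinB; ring.
Qed.

Lemma sin_pathn n : sin (n.+2%:R * t n) = 0.
Proof. by rewrite path_angleM sinpi. Qed.

(* Every vector on the path is a modulation w of the ground state of the form
   path_energy, whose entries are (-1)^k sin ((k + 1) t). *)
Definition path_wave n (w : nat -> R) k := (-1) ^+ k * sin (k.+1%:R * t n) * w k.

Lemma path_energy_wave n w :
  path_energy n (path_wave n w) =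
  path_eigval n * (\sum_(k < n.+1) path_wave n w k ^+ 2)
  + \sum_(k < n) sin (k.+1%:R * t n) * sin (k.+2%:R * t n) * (w k.+1 - w k) ^+ 2.
Proof.
rewrite /path_wave (@picone_path _ n (cos (t n)) (fun k => sin (k%:R * t n))) //.
- by rewrite sin_pathn !mul0r addr0.
- by rewrite mul0r sin0.
- by move=> k; exact: sin_path_rec.
Qed.

(** The ground state has no zero on the path, so it can be divided out. *)
Lemma path_waveP n (F : nat -> R) :
  exists w, forall k, (k < n.+1)%N -> F k = path_wave n w k.
Proof.
exists (fun k => (-1) ^+ k * F k / sin (k.+1%:R * t n)) => k kn.
rewrite /path_wave; have : sin (k.+1%:R * t n) != 0 by rewrite gt_eqF // sin_path_gt0.
move=> s0; transitivity (((-1) ^+ k) ^+ 2 * F k); last by field.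
by rewrite sqrr_sign mul1r.
Qed.

Lemma eq_path_energy n (F G : nat -> R) : (forall k, (k < n.+1)%N -> F k = G k) ->
  path_energy n F = path_energy n G.
Proof.
move=> FG; rewrite /path_energy !FG //; congr (_ + _ + _).
by apply: eq_bigr => k _; rewrite !FG // ?ltnS // ltnW // ltnS.
Qed.

Lemma path_poincare n (F : nat -> R) :
  path_eigval n * (\sum_(k < n.+1) F k ^+ 2) <= path_energy n F.
Proof.
have [w Fw] := path_waveP n F.
rewrite (eq_path_energy Fw) path_energy_wave.
rewrite (eq_bigr _ (fun (k : 'I_n.+1) _ => congr1 (fun x => x ^+ 2) (Fw k (ltn_ord k)))).
rewrite lerDl; apply: sumr_ge0 => k _.
by rewrite mulr_ge0 ?sqr_ge0 // mulr_ge0 // ltW // sin_path_gt0 //= ltnS ?ltnS // ltnW // ltnS.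
Qed.

(** * Bounding the sum of a vector by its energy excess *)

(** A discrete primitive of the ground state, up to the factor -2 cos (t/2). The constant makes it
    vanish at 0 and, for n odd, also at n.+1. *)
Definition wave_primitive n k : R :=
  (-1) ^+ k * sin (k%:R * t n + t n / 2) - sin (t n / 2).

Lemma wave_primitiveB n k :
  wave_primitive n k - wave_primitive n k.+1 =
  2 * cos (t n / 2) * ((-1) ^+ k * sin (k.+1%:R * t n)).
Proof.
rewrite /wave_primitive exprS.
have -> : k%:R * t n + t n / 2 = k.+1%:R * t n - t n / 2 by field.
by rewrite sinB sinD; ring.
Qed.

Lemma wave_primitive0 n : wave_primitive n 0 = 0.
Proof. by rewrite /wave_primitive mul0r add0r mul1r subrr. Qed.

Lemma wave_primitiven n : wave_primitive n n.+1 = ((-1) ^+ n.+1 - 1) * sin (t n / 2).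
Proof.
rewrite /wave_primitive.
have -> : n.+1%:R * t n + t n / 2 = pi - t n / 2.
  by rewrite -(path_angleM n); field.
by rewrite sinB sinpi cospi; ring.
Qed.

(** Summation by parts. The boundary term survives exactly for n even, which is what separates the
    two parities. *)
Lemma path_wave_sum n (w : nat -> R) :
  2 * cos (t n / 2) * (\sum_(k < n.+1) path_wave n w k) =
  (1 - (-1) ^+ n.+1) * sin (t n / 2) * w n
  + \sum_(k < n) wave_primitive n k.+1 * (w k.+1 - w k).
Proof.
have := abel_sum n (wave_primitive n) w.
rewrite wave_primitive0 wave_primitiven => h.
rewrite mulr_sumr (eq_bigr (fun k : 'I_n.+1 =>
  (wave_primitive n k - wave_primitive n k.+1) * w k)).
  by rewrite h; ring.
by move=> k _; rewrite wave_primitiveB /path_wave; ring.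
Qed.

(* Writing s for the half-angle sine and S = sin ((k + 3/2) t), the weight
   sin ((k + 1) t) sin ((k + 2) t) is (S - s)(S + s), and S is at least
   sin (3 t / 2) = (1 + 2 cos t) s. *)
Lemma wave_primitive_le n k : (k < n)%N -> 0 < cos (t n) ->
  cos (t n) * wave_primitive n k.+1 ^+ 2 <=
  (1 + cos (t n)) * (sin (k.+1%:R * t n) * sin (k.+2%:R * t n)).
Proof.
move=> kn q0; set q := cos (t n); set s := sin (t n / 2).
have s0 : 0 < s := sin_half_path_angle_gt0 n.
pose S := sin (k.+1%:R * t n + t n / 2).
have qE : q = 1 - 2 * s ^+ 2 := cos_half _.
have sS : (1 + 2 * q) * s <= S.
  have a0 := path_angle_gt0 n.
  have a0' := ltW a0.
  pose u := k%:R * t n / 2.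
  have -> : S = sin (t n + t n / 2 + u + u).
    by rewrite /S; congr sin; rewrite /u; field.
  have -> : (1 + 2 * q) * s = sin ((t n + t n / 2 + u) - u).
    rewrite addrK {1}(splitr (t n)) !sinD !cosD -/s.
    rewrite qE; have := cos2sin2 (t n / 2); rewrite -/s; set c := cos _ => c2.
    transitivity (s * (3 * c ^+ 2 - s ^+ 2)); last by ring.
    by rewrite c2; ring.
  (* The difference sin (X + u) - sin (X - u) is 2 cos X sin u, and k < n keeps X = (k + 3) t / 2
     below or at pi / 2. *)
  set X := t n + t n / 2 + u.
  rewrite -subr_ge0 (_ : _ - _ = 2 * (cos X * sin u)); last first.
    by rewrite sinB sinD; ring.
  rewrite mulr_ge0 // mulr_ge0 //.
    apply: cos_ge0_pihalf; apply/andP; split.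
      rewrite (@le_trans _ _ 0) // ?oppr_le0 ?divr_ge0 ?pi_ge0 //.
      have : 0 <= k%:R * t n by rewrite mulr_ge0.
      by rewrite /X /u; lra.
    rewrite (_ : X = k.+3%:R * t n / 2); last by rewrite /X /u; field.
    by rewrite ler_pM2r ?invr_gt0 // -(path_angleM n) ler_pM2r // ler_nat.
  have u0 : 0 <= k%:R * t n by rewrite mulr_ge0.
  have u1 : k%:R * t n <= pi.
    by rewrite -(path_angleM n) ler_wpM2r // ler_nat; lia.
  by apply: sin_ge0_pi; rewrite /u; lra.
have -> : sin (k.+1%:R * t n) * sin (k.+2%:R * t n) = (S - s) * (S + s).
  rewrite /S; set x := k.+1%:R * t n + t n / 2.
  transitivity (sin (x - t n / 2) * sin (x + t n / 2)).
    by congr (sin _ * sin _); rewrite /x; field.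
  clearbody x; rewrite sinB sinD -/s.
  transitivity (sin x ^+ 2 * cos (t n / 2) ^+ 2 - cos x ^+ 2 * s ^+ 2); first by ring.
  by rewrite !cos2sin2 -/s; ring.
(* Depending on parity the primitive is S - s or -(S + s); as S and s are positive, the second has
   the larger square. *)
have PS : wave_primitive n k.+1 ^+ 2 <= (S + s) ^+ 2.
  rewrite /wave_primitive -/S -/s -signr_odd; case: (odd _).
    by rewrite expr1 (_ : _ - _ = - (S + s)) ?sqrrN //; ring.
  rewrite expr0 mul1r -subr_ge0 (_ : _ - _ = 4 * (S * s)); last by ring.
  rewrite mulr_ge0 // mulr_ge0 ?ltW // (lt_le_trans _ sS) // mulr_gt0 //.
  by rewrite /q; lra.
apply: (le_trans (ler_wpM2l (ltW q0) PS)).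
have Ss0 : 0 <= S + s by rewrite -/q in q0; nra.
(* With S + s cancelled there remains q (S + s) <= (1 + q) (S - s), which is [sS]. *)
rewrite expr2 mulrA mulrA; apply: ler_wpM2r => //; rewrite -/q; lra.
Qed.

Lemma wave_sum_le n (w : nat -> R) : odd n -> 0 < cos (t n) ->
  2 * cos (t n) * (\sum_(k < n.+1) path_wave n w k) ^+ 2 <=
  n%:R * \sum_(k < n) sin (k.+1%:R * t n) * sin (k.+2%:R * t n) * (w k.+1 - w k) ^+ 2.
Proof.
move=> on q0; set q := cos (t n) in q0 *.
have := path_wave_sum n w; rewrite exprS -(signr_odd _ n) on expr1 mulN1r opprK subrr !mul0r add0r.
set s := \sum_(k < n.+1) _ => e.
have c2 : 4 * cos (t n / 2) ^+ 2 = 2 * (1 + q).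
  by rewrite cos2sin2 /q cos_half; ring.
have q1 : 0 < 1 + q by rewrite addr_gt0.
rewrite -(ler_pM2l q1).
have -> : (1 + q) * (2 * q * s ^+ 2) = q * (2 * cos (t n / 2) * s) ^+ 2.
  by rewrite !exprMn -natrX c2; ring.
rewrite e.
apply: (le_trans (ler_wpM2l (ltW q0)
  (sqr_sum_le n (fun k => wave_primitive n k.+1 * (w k.+1 - w k))))).
rewrite mulrCA [leRHS]mulrCA ler_wpM2l // !mulr_sumr; apply: ler_sum => k _.
rewrite exprMn mulrA [leRHS]mulrA ler_wpM2r ?sqr_ge0 //.
exact: wave_primitive_le.
Qed.

(** * Trigonometric estimate of the comparison factor *)

(* k tan x <= tan (k x), cleared of denominators. *)
Lemma mul_sin_cos_le (k : nat) (x : R) : 0 <= x <= pi / 2 -> k%:R * x <= pi ->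
  k%:R * sin x * cos (k%:R * x) <= sin (k%:R * x) * cos x.
Proof.
move=> /andP[x0 x1]; elim: k => [|k IHk] kx; first by rewrite !mul0r sin0 mul0r.
have kx' : k%:R * x <= pi by rewrite (le_trans _ kx) // ler_wpM2r // ler_nat.
have sk : 0 <= sin (k%:R * x) by rewrite sin_ge0_pi // kx' mulr_ge0.
have cx : 0 <= cos x.
  by rewrite cos_ge0_pihalf // x1 (le_trans _ x0) // oppr_le0 divr_ge0 ?pi_ge0.
have -> : k.+1%:R * x = k%:R * x + x by rewrite -natr1 mulrDl mul1r.
rewrite sinD cosD -subr_ge0.
rewrite [leRHS](_ : _ = cos x * (sin (k%:R * x) * cos x - k%:R * sin x * cos (k%:R * x))
  + k.+1%:R * (sin x ^+ 2 * sin (k%:R * x))); last by rewrite -natr1; ring.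
apply: addr_ge0; first by rewrite mulr_ge0 // subr_ge0 IHk.
by rewrite mulr_ge0 // mulr_ge0 // sqr_ge0.
Qed.

Lemma sin_half_path_angle_le n m : n = m.*2.+1 -> m.+2%:R * sin (t n / 2) <= 1.
Proof.
move=> nm; set x := t n / 2; set k := m.+1.
have x0 : 0 < x := half_path_angle_gt0 n.
(* Since (2k + 1) x = pi / 2, the angles 2kx and x are complementary. Double-angle formulas then
   turn k tan x <= tan (k x) into k sin x <= 1 - sin x. *)
have xE : k%:R * x + (k%:R * x + x) = pi / 2.
  by rewrite /k /x -(path_angleM n) nm -mul2n; field.
have kx : k%:R * x < pi / 2 by rewrite -xE ltrDl addr_gt0 // mulr_gt0.
have p0 : 0 < pi / 2 :> R by rewrite divr_gt0 ?pi_gt0.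
have ck : 0 < cos (k%:R * x).
  by apply: cos_gt0_pihalf; rewrite kx (lt_trans _ (mulr_gt0 _ x0)) ?oppr_lt0.
have := @mul_sin_cos_le k x.
rewrite ltW //= ltW ?half_path_angle_lt // => /(_ isT).
have kpi : k%:R * x <= pi by apply: (le_trans (ltW kx)); have := pi_gt0 R; lra.
move=> /(_ kpi); rewrite -(ler_pM2r ck).
have s2 : 2 * (sin (k%:R * x) * cos (k%:R * x)) = cos x.
  have -> : cos x = sin (k%:R * x + k%:R * x).
    have -> : k%:R * x + k%:R * x = pi / 2 - x by lra.
    by rewrite sinB sin_pihalf cos_pihalf; ring.
  by rewrite sinD; ring.
have c2 : 2 * cos (k%:R * x) ^+ 2 = 1 + sin x.
  have -> : sin x = cos (k%:R * x + k%:R * x).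
    have -> : k%:R * x + k%:R * x = pi / 2 - x by lra.
    by rewrite cosB sin_pihalf cos_pihalf; ring.
  by rewrite cosD -!expr2 sin2cos2; ring.
have c2x := cos2sin2 x.
have sx : 0 < sin x := sin_half_path_angle_gt0 n.
rewrite -(ler_pM2l (@ltr0Sn R 1)).
rewrite [leLHS](_ : _ = k%:R * sin x * (2 * cos (k%:R * x) ^+ 2)); last by ring.
rewrite [leRHS](_ : _ = cos x * (2 * (sin (k%:R * x) * cos (k%:R * x)))); last by ring.
rewrite s2 c2 -expr2 c2x (_ : 1 - _ = (1 - sin x) * (1 + sin x)); last by ring.
rewrite ler_pM2r; last by rewrite addr_gt0.
by rewrite /k -!natr1; lra.
Qed.

Lemma path_cos_bound n m : n = m.*2.+1 ->
  m.+2%:R ^+ 2 * (n.+1%:R * (1 - cos (t n))) <= 4 * m.+1%:R.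
Proof.
move=> nm; have h := sin_half_path_angle_le nm.
have s0 := sin_half_path_angle_gt0 n.
rewrite cos_half [leLHS](_ : _ = 4 * m.+1%:R * (m.+2%:R * sin (t n / 2)) ^+ 2).
  by rewrite ler_piMr // expr_le1 // mulr_ge0 // ltW.
by rewrite nm (_ : m.*2.+2 = m.+1 * 2)%N ?natrM; [ring | lia].
Qed.

(** Follows from 4 (m + 1) = (m + 2)^2 - m^2. The bound amounts to n (1 - cos t) <= cos t, the form
    in which it serves later. *)
Lemma path_cos_slack n m : n = m.*2.+1 ->
  n.+1%:R * (1 - cos (t n)) <= 1 /\
  ((0 < m)%N -> n.+1%:R * (1 - cos (t n)) < 1).
Proof.
move=> nm; have h := path_cos_bound nm.
have m2 : 0 < (m.+2%:R ^+ 2 : R) by rewrite exprn_gt0.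
have e : m.+2%:R ^+ 2 = 4 * m.+1%:R + m%:R ^+ 2 :> R by rewrite -(natr1 m.+1) -(natr1 m); ring.
split=> [|m0].
  rewrite -(ler_pM2l m2) mulr1 (le_trans h) // e lerDl sqr_ge0 //.
by rewrite -(ltr_pM2l m2) mulr1 (le_lt_trans h) // e ltrDl exprn_gt0 // ltr0n.
Qed.

Lemma path_cos_gt0 n : odd n -> 0 < cos (t n).
Proof.
move=> on; have [|h _] := @path_cos_slack n n./2; first by rewrite -[LHS]odd_double_half on.
have n1 : 2 <= n.+1%:R :> R by rewrite ler_nat; case: (n) on.
by rewrite ltNge; apply/negP => q0; nra.
Qed.

(** * Bounds on the constant for each parity *)

Lemma path_sum_sqr_le n (F : nat -> R) : odd n ->
  cos (t n) * (path_eigval n * (\sum_(k < n.+1) F k) ^+ 2) <=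
  n%:R * (1 - cos (t n)) *
    (path_energy n F - path_eigval n * \sum_(k < n.+1) F k ^+ 2).
Proof.
move=> on; have [w Fw] := path_waveP n F.
rewrite (eq_path_energy Fw).
under eq_bigr do rewrite Fw //.
under [in leRHS]eq_bigr do rewrite Fw //.
rewrite path_energy_wave addrAC subrr add0r.
rewrite [leLHS](_ : _ = (1 - cos (t n)) *
    (2 * cos (t n) * (\sum_(k < n.+1) path_wave n w k) ^+ 2)); last first.
  by rewrite /path_eigval; ring.
rewrite [leRHS]mulrAC [leRHS]mulrC ler_wpM2l ?subr_ge0 ?cos_le1 //.
exact: wave_sum_le (path_cos_gt0 on).
Qed.

Lemma path_norm_le n (F : nat -> R) : odd n ->
  path_eigval n * path_norm n F <= path_energy n F.
Proof.
move=> on; have q0 := path_cos_gt0 on.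
have [|h _] := @path_cos_slack n n./2; first by rewrite -[LHS]odd_double_half on.
rewrite mulrDr -lerBrDl -(ler_pM2l q0) (le_trans (path_sum_sqr_le F on)) //.
apply: ler_wpM2r; first by rewrite subr_ge0 path_poincare.
by move: h; rewrite -natr1; lra.
Qed.

Lemma path_ground_norm_gt0 n : 0 < \sum_(k < n.+1) path_wave n (fun=> 1) k ^+ 2.
Proof.
rewrite big_ord_recl /= ltr_pwDl ?sumr_ge0 // => [|k _]; last exact: sqr_ge0.
by rewrite exprn_gt0 // /path_wave mul1r mulr1 sin_path_gt0.
Qed.

Lemma path_ground_energy n : path_energy n (path_wave n (fun=> 1)) =
  path_eigval n * \sum_(k < n.+1) path_wave n (fun=> 1) k ^+ 2.
Proof.
rewrite path_energy_wave [X in _ + X]big1 ?addr0 // => k _.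
by rewrite subrr expr0n mulr0.
Qed.

Lemma path_ground_sum n : ~~ odd n -> \sum_(k < n.+1) path_wave n (fun=> 1) k != 0.
Proof.
move=> on; have := path_wave_sum n (fun=> 1).
rewrite [X in _ + X]big1 => [|k _]; last by rewrite subrr mulr0.
rewrite exprS -(signr_odd _ n) (negPf on) expr0 addr0 !mulr1 opprK => e.
apply/eqP => s0; move: e; rewrite s0 mulr0 => /esym/eqP; apply/negP.
by rewrite gt_eqF // mulr_gt0 // sin_half_path_angle_gt0.
Qed.

Lemma QEC_fan_ge n : - path_eigval n <= QEC_fan R n.+1.
Proof.
have G0 := path_ground_norm_gt0 n.
apply: (@le_QEC_fan _ _ (path_wave n (fun=> 1))).
  by rewrite ltr_pwDl ?sqr_ge0.
by rewrite path_ground_energy ler_pM2l ?path_eigval_gt0 // lerDl sqr_ge0.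
Qed.

(** The ground state has nonzero sum, so its hub value enlarges the norm and strictly lowers the
    Rayleigh quotient. *)
Lemma QEC_fan_gt n : ~~ odd n -> - path_eigval n < QEC_fan R n.+1.
Proof.
move=> on; have G0 := path_ground_norm_gt0 n; have s0 := path_ground_sum on.
set w := path_wave n _ in G0 s0.
have N0 : \sum_(k < n.+1) w k ^+ 2 < path_norm n w.
  by rewrite ltrDl exprn_even_gt0.
apply: (@lt_le_trans _ _ (- (path_energy n w / path_norm n w))).
  rewrite ltrN2 ltr_pdivrMr ?(lt_trans G0) // path_ground_energy.
  by rewrite ltr_pM2l ?path_eigval_gt0.
by apply: (@le_QEC_fan _ _ w); rewrite ?(lt_trans G0) // mulfVK // gt_eqF // (lt_trans G0).
Qed.

Lemma QEC_fan_odd n : odd n -> QEC_fan R n.+1 = - path_eigval n.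
Proof.
move=> on; apply/eqP; rewrite eq_le QEC_fan_ge andbT.
by apply: QEC_fan_le => F; exact: path_norm_le.
Qed.

(** * Strict upper bound through the path with one more vertex *)

Lemma path_extend0 n (F : nat -> R) (F' := fun k => if (k <= n)%N then F k else 0) :
  [/\ path_energy n.+1 F' = path_energy n F,
      \sum_(k < n.+2) F' k ^+ 2 = \sum_(k < n.+1) F k ^+ 2
    & \sum_(k < n.+2) F' k = \sum_(k < n.+1) F k].
Proof.
have F'E k : (k <= n)%N -> F' k = F k by rewrite /F' => ->.
have F'n : F' n.+1 = 0 by rewrite /F' ltnn.
split; last 2 first.
- rewrite big_ord_recr /= F'n expr0n addr0.
  by apply: eq_bigr => k _; rewrite F'E // -ltnS.
- by rewrite big_ord_recr /= F'n addr0; apply: eq_bigr => k _; rewrite F'E // -ltnS.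
rewrite /path_energy big_ord_recr /= F'n expr0n !addr0 addrA !F'E //.
congr (_ + _ + _); apply: eq_bigr => k _.
by rewrite !F'E // ltnW.
Qed.

(* Padding by a zero gives the non-strict inequality. Strictness of the supremum
   needs a uniform gap e: it comes from the slack in path_sum_sqr_le and from the
   larger Dirichlet eigenvalue of the shorter path. *)
Lemma QEC_fan_lt n : ~~ odd n -> (0 < n)%N -> QEC_fan R n.+1 < - path_eigval n.+1.
Proof.
move=> on n0; have on1 : odd n.+1 by [].
have q0 := path_cos_gt0 on1; set q := cos (t n.+1) in q0.
have nm : n.+1 = n./2.*2.+1 by rewrite -[n in LHS]odd_double_half (negPf on).
have [_ h] := path_cos_slack nm.
have {h} : n.+2%:R * (1 - q) < 1 by apply: h; lia.
rewrite -(natr1 n.+1) => h.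
pose kap := n.+1%:R * (1 - q) / q.
have kap1 : kap < 1 by rewrite /kap ltr_pdivrMr //; lra.
have kap0 : 0 <= kap by rewrite divr_ge0 ?(ltW q0) // mulr_ge0 // subr_ge0 cos_le1.
set l := path_eigval n.+1; have l0 : 0 < l := path_eigval_gt0 n.+1.
have ll := path_eigval_lt n; rewrite -/l in ll; set l' := path_eigval n in ll.
(* K bounds the norm by the energy excess d - l g: the first term handles g, by the spectral gap,
   and the second handles s. *)
pose K := (l' - l)^-1 + kap / l.
have K0 : 0 < K by apply: ltr_wpDr; [exact: divr_ge0 kap0 (ltW l0) | rewrite invr_gt0 subr_gt0].
(* A share [kap] of the excess pays for l s; the remaining 1 - [kap] pays for the gap e. *)
pose e := (1 - kap) / K.
have e0 : 0 < e by rewrite divr_gt0 // subr_gt0.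
apply: (@le_lt_trans _ _ (- (l + e))); last by rewrite ltrN2 ltrDl.
apply: QEC_fan_le => F; rewrite /path_norm.
have := path_poincare n F; rewrite -/l'.
have [E G S] := path_extend0 n F.
have := path_sum_sqr_le (fun k => if (k <= n)%N then F k else 0) on1.
rewrite E G S -/l -/q; set g := \sum_(k < n.+1) F k ^+ 2; set s := _ ^+ 2.
set d := path_energy n F => hs hg.
have {}hs : l * s <= kap * (d - l * g).
  by rewrite /kap [leRHS]mulrAC ler_pdivlMr // mulrC.
have gK : g <= (l' - l)^-1 * (d - l * g).
  by rewrite mulrC ler_pdivlMr ?subr_gt0 //; lra.
have sK : s <= kap / l * (d - l * g).
  by rewrite mulrAC ler_pdivlMr // mulrC.
have NK : g + s <= K * (d - l * g) by rewrite /K mulrDl lerD.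
have : e * (g + s) <= (1 - kap) * (d - l * g).
  apply: (le_trans (ler_wpM2l (ltW e0) NK)).
  by rewrite /e mulrA mulfVK // gt_eqF.
by lra.
Qed.

(** * Initial value, monotonicity and limit *)

Lemma QEC_fan3 : QEC_fan R 3 = - (1 / 2).
Proof.
apply/eqP; rewrite eq_le; apply/andP; split.
  apply: QEC_fan_le => F; rewrite /path_energy /path_norm !big_ord_recr !big_ord0 /=.
  (* Energy minus half the norm is half the sum of these three squares, all zero at (1, -1, 1). *)
  have := sqr_ge0 (F 0%N + F 1%N); have := sqr_ge0 (F 1%N + F 2%N).
  have := sqr_ge0 (F 0%N - F 2%N); lra.
apply: (@le_QEC_fan _ _ (fun k => (-1) ^+ k));
  rewrite /path_energy /path_norm !big_ord_recr !big_ord0 /=; lra.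
Qed.

(** The values interlace with the negated eigenvalues: for n odd -l(n) < -l(n+1) lies between the
    two constants, for n even the strict upper bound is the next constant. *)
Lemma QEC_fan_ltS n : (2 <= n)%N -> QEC_fan R n.+1 < QEC_fan R n.+2.
Proof.
move=> n2; have [on|on] := boolP (odd n).
  rewrite QEC_fan_odd // (@lt_trans _ _ (- path_eigval n.+1)) //.
    by rewrite ltrN2 path_eigval_lt.
  by apply: QEC_fan_gt; rewrite /= on.
by rewrite (QEC_fan_odd (n := n.+1)) //= QEC_fan_lt // (leq_trans _ n2).
Qed.

Lemma QEC_fan_cvg : QEC_fan R n @[n --> \oo] --> (0 : R).
Proof.
have F0 n : QEC_fan R n.+1 <= 0.
  rewrite -oppr0; apply: QEC_fan_le => F.
  by rewrite mul0r path_energy_ge0.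
rewrite -(cvg_shiftS (QEC_fan R)).
apply: (@squeeze_cvgr _ _ _ _ (fun n => - path_eigval n) (cst 0)).
- by near=> n; rewrite QEC_fan_ge F0.
- rewrite -[X in _ --> X](_ : - (4 * sin (0 : R) ^+ 2) = 0); last first.
    by rewrite sin0 expr0n mulr0 oppr0.
  under eq_fun do rewrite path_eigvalE.
  apply: cvgN; apply: cvgM; first exact: cvg_cst.
  rewrite expr2; under eq_fun do rewrite expr2.
  have h : sin (t n / 2) @[n --> \oo] --> sin (0 : R).
    apply: (@continuous_cvg _ _ _ _ _ (fun n => t n / 2) (@sin R)).
      exact: continuous_sin.
    rewrite -(mul0r 2^-1) -(mulr0 pi); apply: cvgM; last exact: cvg_cst.
    apply: cvgM; first exact: cvg_cst.
    by rewrite (cvg_shiftS (@harmonic R)); exact: cvg_harmonic.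
  by apply: cvgM.
- exact: cvg_cst.
Unshelve. all: by end_near.
Qed.

End PathAngle.

Theorem mainTheorem10 (R : realType) :
  (forall n : nat, (1 <= n)%N ->
     QEC_fan R (2 * n) = - 4 * sin (pi / (2 * (2 * n%:R + 1))) ^+ 2) /\
  (forall n : nat, (1 <= n)%N ->
     - 4 * sin (pi / (2 * (2 * n%:R + 2))) ^+ 2 < QEC_fan R (2 * n + 1) /\
     QEC_fan R (2 * n + 1) < - 4 * sin (pi / (2 * (2 * n%:R + 3))) ^+ 2) /\
  QEC_fan R 3 = - (1 / 2) /\
  (forall n : nat, (3 <= n)%N -> QEC_fan R n < QEC_fan R n.+1) /\
  (QEC_fan R n @[n --> \oo] --> (0 : R)).
Proof.
(* Index n stands for n + 1 path vertices, so the denominator x is n + 2. *)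
have eigE (n k : nat) (x : R) : n.+2%:R = x ->
    - 4 * sin (pi / (2 * x)) ^+ 2 = - path_eigval R n.
  move=> <-; rewrite path_eigvalE mulNr /path_angle.
  by congr (- (_ * sin _ ^+ 2)); field.
split; last split; last split; last split.
- move=> [//|n] _; rewrite (eigE n.*2.+1 n); last by rewrite -mul2n; ring.
  by rewrite mul2n doubleS QEC_fan_odd //= odd_double.
- move=> [//|n] _; rewrite (eigE n.*2.+2 n); last by rewrite -mul2n; ring.
  rewrite (eigE n.*2.+3 n); last by rewrite -mul2n; ring.
  rewrite mul2n doubleS addn1.
  by split; [apply: QEC_fan_gt | apply: QEC_fan_lt]; rewrite //= odd_double.
- exact: QEC_fan3.
- by move=> [//|n] n2; exact: QEC_fan_ltS.
- exact: QEC_fan_cvg.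
Qed.
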